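(* There is a set $X$ and a subset $S$ of $\mathbb{U}^{\circ}X$ that is Lindelöf but not $\sigma$-compact (as a subspace of $\mathbb{U}X$ with its Stone topology).
   Context: $\mathbb{U}X$ is the set of all ultrafilters on $X$, with the Stone topology $\beta$, having as a base the sets $\beta A=\{\mathcal{U}\in\mathbb{U}X:A\in\mathcal{U}\}$, $A\subset X$. $\mathbb{U}^\circ X\subset\mathbb{U}X$ is the set of free (non-principal) ultrafilters. Lindelöf means every open cover has a countable subcover (no separation axiom is included). *)

(* Defs.v *)
From HB Require Import structures.
From mathcomp Require Import all_boot all_order all_algebra.
From mathcomp Require Import all_classical all_reals.
From mathcomp Require Import topology.

Set Implicit Arguments.
Unset Strict Implicit.
Unset Printing Implicit Defensive.

Local Open Scope classical_set_scope.

Record ultrafilter (X : Type) := MkUltrafilter {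
  ultrafilter_sets :> (X -> Prop) -> Prop ;
  ultrafilterP : UltraFilter ultrafilter_sets
}.

#[export] Existing Instance ultrafilterP.

HB.instance Definition _ (X : Type) := gen_eqMixin (ultrafilter X).
HB.instance Definition _ (X : Type) := gen_choiceMixin (ultrafilter X).

Definition stone_set (X : Type) (A : set X) : set (ultrafilter X) :=
  [set U : ultrafilter X | U A].

Lemma stone_set_cover (X : Type) :
  \bigcup_(A in [set: set X]) stone_set A = [set: ultrafilter X].
Proof. by rewrite -subTset => U _; exists setT => //; exact: filterT. Qed.

Lemma stone_set_join (X : Type) (A B : set X) (U : ultrafilter X) :
  [set: set X] A -> [set: set X] B -> stone_set A U -> stone_set B U ->
  exists C, [/\ [set: set X] C, stone_set C U &
                stone_set C `<=` stone_set A `&` stone_set B].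
Proof.
move=> _ _ UA UB; exists (A `&` B); split=> //; first exact: filterI.
by move=> V VAB; split; apply: filterS VAB => x [].
Qed.

HB.instance Definition _ (X : Type) :=
  isBaseTopological.Build (ultrafilter X)
    (@stone_set_cover X) (@stone_set_join X).

Definition free_ultrafilters (X : Type) : set (ultrafilter X) :=
  [set U : ultrafilter X | forall x : X,
    (U : set_system X) <> principal_filter x].

(* As for the library's [compact], the two notions below are stated for a
   subset [S] of an ambient space [T], and describe the subspace [S]: a cover
   of [S] by open sets of [T] traces the open covers of the subspace. *)
Definition lindelof (T : topologicalType) (S : set T) : Prop :=
  forall C : set (set T), C `<=` open -> S `<=` \bigcup_(A in C) A ->
  exists C' : set (set T),
    [/\ C' `<=` C, countable C' & S `<=` \bigcup_(A in C') A].

Definition sigma_compact (T : topologicalType) (S : set T) : Prop :=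
  exists K : nat -> set T, (forall n, compact (K n)) /\ S = \bigcup_n K n.

(* Main.v *)
(** The set [\bigcap_n \bigcup_k A n k], with all [A n k] closed in a compact
    space, is Lindelöf: given an open cover, every branch [g] has a prefix [s]
    for which [\bigcap_(i < size s) A i (s_i)] is countably covered, since
    otherwise the complements of countable unions from the cover would cluster
    at a point of [\bigcap_i A i (g i)]; and there are only countably many
    prefixes.  On [(nat -> nat) * nat], take for [A n k] the free ultrafilters
    containing [{(f, m) | f n = k}].  Each compact set in the intersection is
    bounded in every coordinate, and a diagonal function escapes countably many
    such bounds. *)
Require Import Defs.
From mathcomp Require Import all_boot all_order all_algebra.
From mathcomp Require Import all_classical all_reals.
From mathcomp Require Import topology.

Local Open Scope classical_set_scope.

Lemma compact_Fsigmadelta_lindelof (T : topologicalType)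
    (A : nat -> nat -> set T) :
  compact [set: T] -> (forall n k, closed (A n k)) ->
  lindelof (\bigcap_n \bigcup_k A n k).
Proof.
move=> Tco Acl C Copen Ccov.
pose P s := \bigcap_(i < size s) A i (nth 0%N s i).
pose coveredby (D : set T) C' :=
  [/\ C' `<=` C, countable C' & D `<=` \bigcup_(B in C') B].
pose good s := exists C', coveredby (P s) C'.
(* One subfamily is fixed per prefix, independently of any point, so the final cover is a union over
   finite sequences of naturals, hence countable. Bad prefixes get the default [set0]. *)
have /choice[c cP] : forall s, exists C', good s -> coveredby (P s) C'.
  move=> s; have [[C' C'P]|ngood] := pselect (good s); first by exists C'.
  by exists set0.
exists (\bigcup_(s in good) c s); split.
- by move=> B [s /cP[+ _ _]]; apply.
- by apply: bigcup_countable => // s /cP[].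
move=> p pA.
have /choice[g gP] : forall n, exists k, A n k p.
  by move=> n; have [k _ Ak] := pA n I; exists k.
have Pmkseq n q : P (mkseq g n) q <-> forall i, (i < n)%N -> A i (g i) q.
  split=> [qP i ilt|qA i].
    by have := qP i; rewrite /mkset size_mkseq nth_mkseq //; apply.
  by rewrite /mkset size_mkseq => ilt; rewrite nth_mkseq //; exact: qA.
have [n gn] : exists n, good (mkseq g n); last first.
  have [_ _] := cP _ gn => /(_ p)[|B cB Bp].
    by apply/Pmkseq => i _; exact: gP.
  by exists B => //; exists (mkseq g n).
apply: contrapT => /forallNP ngood.
have Pmono m n : (m <= n)%N -> P (mkseq g n) `<=` P (mkseq g m).
  move=> mn q /Pmkseq qA; apply/Pmkseq => i im; apply: qA.
  exact: leq_trans mn.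
(* [F] is generated by the sets [P (mkseq g n)] and the complements of countable unions from [C]; it
   is proper exactly because no prefix of [g] is good. *)
pose F : set_system T :=
  [set E | exists n, exists2 C', C' `<=` C /\ countable C' &
           P (mkseq g n) `<=` E `|` \bigcup_(B in C') B].
have FF : ProperFilter F.
  apply: Build_ProperFilter_ex.
    move=> E [n [C' [C'C C'cnt] PE]]; apply: contrapT => /forallNP E0.
    by apply: (ngood n); exists C'; split => // q /PE[/E0|].
  split.
  - by exists 0%N, set0; [split=> //; exact: sub0set|left].
  - move=> D E [n [C1 [C1C C1cnt] PD]] [m [C2 [C2C C2cnt] PE]].
    exists (maxn n m), (C1 `|` C2).
      split; first by move=> B [/C1C|/C2C].
      by rewrite -bigcup2E; apply: bigcup_countable => // -[|[|]].
    move=> q qP.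
    have /PD[Dq|[B C1B Bq]] := Pmono _ _ (leq_maxl n m) _ qP; last first.
      by right; exists B => //; left.
    have /PE[Eq|[B C2B Bq]] := Pmono _ _ (leq_maxr n m) _ qP; last first.
      by right; exists B => //; right.
    by left.
  - move=> D E DE [n [C' C'P PD]]; exists n, C' => //.
    by move=> q /PD[/DE|]; [left|right].
have [|q [_ Fq]] := Tco F; first exact: filterT.
(* The closed set [A i (g i)] belongs to [F], since it contains [P] of the prefix of length [i.+1];
   so it contains the cluster point [q]. *)
have qA i : A i (g i) q.
  apply: Acl => B Bq; apply: Fq => //.
  exists i.+1, set0; first by split=> //; exact: sub0set.
  by move=> r /Pmkseq rA; left; exact: rA.
have [B CB Bq] : (\bigcup_(B in C) B) q.
  by apply: Ccov => n _; exists (g n).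
(* [B] is a neighbourhood of [q], while its complement lies in [F], by the empty prefix and the
   subfamily [[set B]]. *)
have [] : ~` B `&` B !=set0; last by move=> r [].
apply: Fq; last exact: (open_nbhs_nbhs (conj (Copen _ CB) Bq)).
exists 0%N, [set B]; first by split => // _ ->.
by move=> r _; have [Br|nBr] := pselect (B r); [right; exists B|left].
Qed.

Lemma ultraNE (T : Type) (F : set_system T) (A : set T) :
  UltraFilter F -> F (~` A) <-> ~ F A.
Proof.
move=> FU; split; last by have [|//] := in_ultra_setVsetC A FU.
by move=> FnA FA; apply: (@filter_not_empty _ F); rewrite -(setICr A);
  exact: filterI.
Qed.

Lemma ultraP (T : Type) (F : set_system T) :
  ProperFilter F -> (forall A, F A \/ F (~` A)) -> UltraFilter F.
Proof.
move=> FF FP; split=> // G GF FG; apply/seteqP; split=> // A GA.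
have [//|/FG GnA] := FP A.
by exfalso; apply: (@filter_not_empty _ G); rewrite -(setICr A);
  exact: filterI.
Qed.

Lemma ultra_fmap (T U : Type) (f : T -> U) (F : set_system T) :
  UltraFilter F -> UltraFilter (f @ F).
Proof.
by move=> FU; apply: ultraP => A; exact: (in_ultra_setVsetC (f @^-1` A)).
Qed.

Section Stone.
Variable X : Type.
Implicit Types (A : set X) (U : ultrafilter X).

Lemma open_stone_set A : open (stone_set A).
Proof. by exists [set A] => //; rewrite bigcup_set1. Qed.

Lemma stone_setC A : stone_set (~` A) = ~` stone_set A.
Proof. by apply/seteqP; split=> U UA; exact/(ultraNE _ U). Qed.

Lemma closed_stone_set A : closed (stone_set A).
Proof. by rewrite -openC -stone_setC; exact: open_stone_set. Qed.

Lemma ultrafilter_compact : compact [set: ultrafilter X].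
Proof.
rewrite compact_ultra => F FU _.
(* The limit of [F]: a set is large when [F]-almost all ultrafilters contain it. *)
pose L : set_system X := [set A | F (stone_set A)].
have LU : UltraFilter L.
  apply: ultraP => [|A]; last first.
    by rewrite /L/= stone_setC; exact: in_ultra_setVsetC.
  apply: Build_ProperFilter_ex.
    by move=> A LA; have [U UA] := filter_ex (F := F) LA; exact: filter_ex UA.
  split.
  - by apply: (@filterS _ F) filterT => U _; exact: filterT.
  - move=> A B LA LB; apply: (@filterS _ F) (@filterI _ F _ _ _ LA LB) => U [].
    exact: filterI.
  - by move=> A B AB; apply: (@filterS _ F) => U; exact: filterS.
exists (MkUltrafilter LU); split=> // N /=.
rewrite nbhsE => -[B [[D _ <-] [A DA LA]] BN].
by apply: (@filterS _ F) LA => U UA; apply: BN; exists A.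
Qed.

(** An ultrafilter containing [[set x]] contains every set through [x], so it is the principal one
    by maximality of the latter. In this form closedness is immediate. *)
Lemma free_ultrafiltersE :
  @free_ultrafilters X = \bigcap_x ~` stone_set [set x].
Proof.
apply/seteqP; split=> U Ufree x.
  move=> _ Ux; apply: (Ufree x).
  apply: (max_filter (UltraFilter := principal_filter_ultra x)) => A.
  by move=> /principal_filterP Ax; apply: filterS Ux => _ ->.
move=> Ux; apply: (Ufree x) => //.
by rewrite /stone_set/= Ux; exact/principal_filterP.
Qed.

Lemma closed_free_ultrafilters : closed (@free_ultrafilters X).
Proof.
rewrite free_ultrafiltersE; apply: closed_bigI => x _.
by rewrite closedC; exact: open_stone_set.
Qed.

End Stone.

(** The unconstrained second coordinate makes room for free ultrafilters over a single function. *)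
Definition graph_slice (n k : nat) : set ((nat -> nat) * nat) :=
  [set x | x.1 n = k].

(** A free ultrafilter on [nat] is pushed forward along the injection [pair g], whose image lies in
    every [graph_slice n (g n)]. *)
Lemma ultrafilter_over (g : nat -> nat) :
  exists2 U : ultrafilter ((nat -> nat) * nat),
    free_ultrafilters U & forall n, U (graph_slice n (g n)).
Proof.
have [G [GU ooG]] := ultraFilterLemma eventually_filter.
have GgU := ultra_fmap _ _ (pair g) G GU.
exists (MkUltrafilter GgU) => /=; last first.
  by move=> n; apply: filterS filterT => m.
rewrite free_ultrafiltersE => -[f m] _ /= Gm.
have : G (~` [set m]).
  apply: ooG; exists m.+1 => // i /= mi im.
  by rewrite im ltnn in mi.
by move=> /(ultraNE _ G); apply; apply: (@filterS _ G) Gm => i /= [_ <-].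
Qed.

Theorem corollary72 :
  exists (X : Type) (S : set (ultrafilter X)),
    [/\ S `<=` @free_ultrafilters X, lindelof S & ~ sigma_compact S].
Proof.
pose A n k := @free_ultrafilters _ `&` stone_set (graph_slice n k).
exists ((nat -> nat) * nat)%type, (\bigcap_n \bigcup_k A n k); split.
- by move=> U /(_ 0%N I)[k _ []].
- apply: compact_Fsigmadelta_lindelof; first exact: ultrafilter_compact.
  by move=> n k; apply: closedI;
    [exact: closed_free_ultrafilters|exact: closed_stone_set].
move=> [K [Kco SK]].
have /choice[b bP] : forall n, exists b, forall U, K n U ->
    exists2 j, (j <= b)%N & U (graph_slice n j).
  move=> n.
  pose bounded b U := exists2 j, (j <= b)%N & U (graph_slice n j).
  (* Near an ultrafilter containing [graph_slice n k], every [b >= k] is a bound; compactness, as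
     near covering along [\oo], makes one bound uniform on [K n]. *)
  have /compact_near_coveringP/(_ nat \oo bounded _)[] := Kco n.
    move=> U KU; have : (\bigcap_n \bigcup_k A n k) U by rewrite SK; exists n.
    move=> /(_ n I)[k _ [_ Uk]].
    exists (stone_set (graph_slice n k), [set b | (k <= b)%N]) => /=.
      split; last by exists k.
      exact: (open_nbhs_nbhs (conj (open_stone_set _ _) Uk)).
    by move=> [V b] /= [Vk kb]; exists k.
  by move=> b _ bP; exists b => U; exact: bP (leqnn b) U.
(* The diagonal function: its value at [n] exceeds the bound for [K n] in coordinate [n]. *)
have [U Ufree Ub] := ultrafilter_over (fun n => (b n).+1).
have : (\bigcap_n \bigcup_k A n k) U.
  by move=> n _; exists (b n).+1 => //; split => //; exact: Ub.
rewrite SK => -[n _ /bP[j jb Uj]].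
(* Two slices in [U] meet, which forces [j = (b n).+1]. *)
have [x [xj xb]] := filter_ex (filterI Uj (Ub n)).
by move: jb; rewrite -xj xb ltnn.
Qed.
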